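(* Let $\ell\in\mathbb{N}_{0}$. Let $\mathfrak{G}:\mathbb{R}^3\to\mathbb{R}$ be either of the following two functions: first, $$\mathfrak{G}(x,y,z)=Q_{4\ell+3}(x,y)\sin z-Q_{4\ell+3}(x,z)\sin y+Q_{4\ell+3}(z,x)\cos y+Q_{4\ell+3}(y,x)\cos z,$$ or, second, $$\begin{aligned}\mathfrak{G}(x,y,z)={}&Q_{4\ell+1}(x,y)\sin z-Q_{4\ell+1}(x,z)\sin y+(8\ell+2)Q_{4\ell}(y,z)\cos x\\&+Q_{4\ell+1}(z,x)\cos y+Q_{4\ell+1}(y,x)\cos z\\&-(8\ell+2)P_{4\ell}(y,z)\sin x\\&+4\ell(8\ell+2)P_{4\ell-1}(x,y)\cos z+4\ell(8\ell+2)P_{4\ell-1}(x,z)\cos y.\end{aligned}$$ Then, in each of the two cases, the vector field on $\mathbb{R}^3$ defined by $$\mathfrak{V}(x,y,z)=\big(\mathfrak{G}(x,y,z),\,\mathfrak{G}(y,z,x),\,\mathfrak{G}(z,x,y)\big)$$ has the octahedral symmetry $\mathbb{O}$ (and also the tetrahedral symmetry $\mathbb{T}$), and satisfies $\nabla\times\mathfrak{V}=\mathfrak{V}$.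
   Context: For an integer $n\ge 0$, $P_n(x,y)=\Re\big((x+iy)^n\big)$ and $Q_n(x,y)=\Im\big((x+iy)^n\big)$ for real $x,y$; in particular $P_0=1$, $Q_0=0$. By convention $P_{-1}=Q_{-1}=0$ (relevant when $\ell=0$). $\mathbb{N}_0=\{0,1,2,\dots\}$, and $\nabla\times$ is the usual curl on $\mathbb{R}^3$ with coordinates $(x,y,z)$. Consider the matrices, acting on column vectors $(x,y,z)^T$, $$\alpha=\begin{pmatrix}1&0&0\\0&-1&0\\0&0&-1\end{pmatrix},\qquad \gamma=\begin{pmatrix}0&1&0\\0&0&1\\1&0&0\end{pmatrix},\qquad \delta=\begin{pmatrix}0&1&0\\1&0&0\\0&0&-1\end{pmatrix}.$$ The tetrahedral group is $\mathbb{T}=\langle\alpha,\gamma\rangle$ (of order $12$), and the octahedral group is $\mathbb{O}=\langle\alpha,\gamma,\delta\rangle$ (of order $24$). A vector field $F$, regarded as a map $\mathbb{R}^3\to\mathbb{R}^3$, has symmetry $\Gamma$ (for a group $\Gamma\subset\mathrm{GL}(3,\mathbb{R})$) if $\epsilon^{-1}\circ F\circ\epsilon=F$ for every $\epsilon\in\Gamma$. *)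

(* Defs.v *)
From HB Require Import structures.
From mathcomp Require Import all_boot all_order all_algebra.
From mathcomp Require Import complex.
From mathcomp Require Import all_classical all_reals all_analysis.
Set Implicit Arguments.
Unset Strict Implicit.
Unset Printing Implicit Defensive.
Import Order.TTheory GRing.Theory Num.Theory.
Import numFieldNormedType.Exports.
Local Open Scope classical_set_scope.
Local Open Scope ring_scope.

Section Defs.
Variable R : realType.
Implicit Types (x y z : R) (l : nat).

(* The index is an integer so that the convention P_{-1} = Q_{-1} = 0 can be
   expressed; the values at indices below -1 are never used. *)
Definition harmP (n : int) x y : R :=
  match n with
  | Posz k => complex.Re ((Complex x y) ^+ k)
  | Negz _ => 0
  end.

Definition harmQ (n : int) x y : R :=
  match n with
  | Posz k => complex.Im ((Complex x y) ^+ k)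
  | Negz _ => 0
  end.

Local Notation P := harmP.
Local Notation Q := harmQ.

Definition G_first l x y z : R :=
  let n := (4 * l + 3)%N%:Z in
  Q n x y * sin z - Q n x z * sin y + Q n z x * cos y + Q n y x * cos z.

Definition G_second l x y z : R :=
  let n := (4 * l)%N%:Z in
  let c := (8 * l + 2)%N%:R in
  Q (n + 1) x y * sin z - Q (n + 1) x z * sin y + c * Q n y z * cos x
  + Q (n + 1) z x * cos y + Q (n + 1) y x * cos z
  - c * P n y z * sin x
  + (4 * l)%N%:R * c * P (n - 1) x y * cos z
  + (4 * l)%N%:R * c * P (n - 1) x z * cos y.

Definition vec3 (a b c : R) : 'cV[R]_3 := \col_i [:: a; b; c]`_i.

Definition cyclic_field (G : R -> R -> R -> R) (p : 'cV[R]_3) : 'cV[R]_3 :=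
  let x := p 0 0 in let y := p 1 0 in let z := p 2 0 in
  vec3 (G x y z) (G y z x) (G z x y).

Definition partial (j : 'I_3) (f : 'cV[R]_3 -> R) (p : 'cV[R]_3) : R :=
  'D_(delta_mx j 0) f p.

Definition curl (F : 'cV[R]_3 -> 'cV[R]_3) (p : 'cV[R]_3) : 'cV[R]_3 :=
  let f i := fun q => F q i 0 in
  vec3 (partial 1 (f 2) p - partial 2 (f 1) p)
       (partial 2 (f 0) p - partial 0 (f 2) p)
       (partial 0 (f 1) p - partial 1 (f 0) p).

Definition mx3 (rows : seq (seq R)) : 'M[R]_3 :=
  \matrix_(i, j) (nth [::] rows i)`_j.

Definition alpha_mx : 'M[R]_3 :=
  mx3 [:: [:: 1; 0; 0]; [:: 0; -1; 0]; [:: 0; 0; -1]].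
Definition gamma_mx : 'M[R]_3 :=
  mx3 [:: [:: 0; 1; 0]; [:: 0; 0; 1]; [:: 1; 0; 0]].
Definition delta3_mx : 'M[R]_3 :=
  mx3 [:: [:: 0; 1; 0]; [:: 1; 0; 0]; [:: 0; 0; -1]].

Definition GL3_subgroup (H : set 'M[R]_3) : Prop :=
  [/\ H `<=` [set A | A \in unitmx],
      H 1%:M,
      (forall A B, H A -> H B -> H (A *m B)) &
      (forall A, H A -> H (invmx A))].

Definition tetrahedral : set 'M[R]_3 :=
  smallest GL3_subgroup [set A | A = alpha_mx \/ A = gamma_mx].
Definition octahedral : set 'M[R]_3 :=
  smallest GL3_subgroup
    [set A | [\/ A = alpha_mx, A = gamma_mx | A = delta3_mx]].

Definition has_symmetry (Gamma : set 'M[R]_3)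
    (F : 'cV[R]_3 -> 'cV[R]_3) : Prop :=
  forall eps, Gamma eps -> (fun v => invmx eps *m F (eps *m v)) = F.

End Defs.

Arguments alpha_mx R : clear implicits.
Arguments gamma_mx R : clear implicits.
Arguments delta3_mx R : clear implicits.
Arguments tetrahedral R : clear implicits.
Arguments octahedral R : clear implicits.

(* Main.v *)
(* Writing z = x + iy, the identities d(z^n) = n z^(n-1) dz and
   (y + ix)^n = i^n conj(z^n) give the partial derivatives of P_n and Q_n and
   their behaviour under sign changes and exchange of the arguments, which
   depends only on n mod 4. Since the field is cyclic, each of the three
   components of curl V = V is the single identity
   G_z(z,x,y) - G_y(y,z,x) = G(x,y,z); in it, the terms that are not in G cancel
   by the exchange rules. *)
Require Import Defs.
From HB Require Import structures.
From mathcomp Require Import all_boot all_order all_algebra.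
From mathcomp Require Import all_classical all_reals all_analysis.
From mathcomp Require Import ring zify.
Import Order.TTheory GRing.Theory Num.Theory.
Import numFieldNormedType.Exports.
Local Open Scope ring_scope.

(** * Recurrences, parity and exchange rules for $P_n$ and $Q_n$ *)

Section Harmonics.
Variable R : realType.
Implicit Types (x y : R) (n k : nat).

Lemma harmP0 x y : harmP 0 x y = 1.
Proof. by []. Qed.

Lemma harmQ0 x y : harmQ 0 x y = 0.
Proof. by []. Qed.

Lemma harmPS n x y : harmP n.+1 x y = x * harmP n x y - y * harmQ n x y.
Proof. by rewrite /harmP /harmQ exprS; case: (_ ^+ n). Qed.

Lemma harmQS n x y : harmQ n.+1 x y = x * harmQ n x y + y * harmP n x y.
Proof. by rewrite /harmP /harmQ exprS; case: (_ ^+ n). Qed.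

Definition harmE := (harmPS, harmQS, harmP0, harmQ0).

(** Powers commute with conjugation. The two claims share one induction because the recurrences
    couple $P$ and $Q$. *)
Lemma harm_oppr n x y :
  harmP n x (- y) = harmP n x y /\ harmQ n x (- y) = - harmQ n x y.
Proof.
elim: n => [|n [IHP IHQ]]; first by rewrite !harmE oppr0.
by rewrite !harmE IHP IHQ; split; ring.
Qed.

Lemma harmP_oppr n x y : harmP n x (- y) = harmP n x y.
Proof. by case: (harm_oppr n x y). Qed.

Lemma harmQ_oppr n x y : harmQ n x (- y) = - harmQ n x y.
Proof. by case: (harm_oppr n x y). Qed.

(** Since $-x+iy=-(x-iy)$, the power is $(-1)^n$ times the conjugate one. *)
Lemma harm_oppl n x y :
  harmP n (- x) y = (-1) ^+ n * harmP n x y /\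
  harmQ n (- x) y = - (-1) ^+ n * harmQ n x y.
Proof.
elim: n => [|n [IHP IHQ]]; first by rewrite !harmE; split; ring.
by rewrite !harmE IHP IHQ exprS; split; ring.
Qed.

Lemma harmP_oppl n x y : harmP n (- x) y = (-1) ^+ n * harmP n x y.
Proof. by case: (harm_oppl n x y). Qed.

Lemma harmQ_oppl n x y : harmQ n (- x) y = - (-1) ^+ n * harmQ n x y.
Proof. by case: (harm_oppl n x y). Qed.

(* y + ix = i (x - iy), so swapping multiplies the conjugate by i^n. *)
Lemma harm_swap4 k x y :
  harmP (4 * k)%N y x = harmP (4 * k)%N x y /\
  harmQ (4 * k)%N y x = - harmQ (4 * k)%N x y.
Proof.
elim: k => [|k [IHP IHQ]]; first by rewrite muln0 !harmE oppr0.
have -> : (4 * k.+1 = (4 * k).+4)%N by lia.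
by rewrite !harmE IHP IHQ; split; ring.
Qed.

Lemma harmP_swap4 k x y : harmP (4 * k)%N y x = harmP (4 * k)%N x y.
Proof. by case: (harm_swap4 k x y). Qed.

Lemma harmQ_swap4 k x y : harmQ (4 * k)%N y x = - harmQ (4 * k)%N x y.
Proof. by case: (harm_swap4 k x y). Qed.

(** The factor on the conjugate is now $i^{4k+2}=-1$. *)
Lemma harmP_swap4D2 k x y : harmP (4 * k).+2 y x = - harmP (4 * k).+2 x y.
Proof. by rewrite !harmE harmP_swap4 harmQ_swap4; ring. Qed.

Lemma harmQ_swap4D2 k x y : harmQ (4 * k).+2 y x = harmQ (4 * k).+2 x y.
Proof. by rewrite !harmE harmP_swap4 harmQ_swap4; ring. Qed.

(** The factor $i^{4k+3}=-i$ exchanges real and imaginary parts. *)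
Lemma harmP_swap4D3 k x y : harmP (4 * k).+3 y x = - harmQ (4 * k).+3 x y.
Proof. by rewrite !harmE harmP_swap4 harmQ_swap4; ring. Qed.

Lemma sign4 k : (-1) ^+ (4 * k) = 1 :> R.
Proof. by rewrite -signr_odd oddM. Qed.

End Harmonics.

(** * Differentials of scalar functions *)

Section Differentials.
Variables (R : realType) (V : normedModType R).
Implicit Types (f g df dg : V -> R) (p : V).

Lemma is_diff_ext f df dg p : is_diff p f df -> df =1 dg -> is_diff p f dg.
Proof. by move=> ? /funext <-. Qed.

Lemma is_diff_add f g df dg p : is_diff p f df -> is_diff p g dg ->
  is_diff p (fun q => f q + g q) (fun v => df v + dg v).
Proof. exact: is_diffD. Qed.

Lemma is_diff_sub f g df dg p : is_diff p f df -> is_diff p g dg ->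
  is_diff p (fun q => f q - g q) (fun v => df v - dg v).
Proof. exact: is_diffB. Qed.

Lemma is_diff_mul f g df dg p : is_diff p f df -> is_diff p g dg ->
  is_diff p (fun q => f q * g q) (fun v => f p * dg v + g p * df v).
Proof. exact: is_diffM. Qed.

Lemma is_diff_const (a : R) p : is_diff p (fun=> a) (fun=> 0).
Proof. exact: is_diff_cst. Qed.

Lemma is_diff_chain (h : R -> R) (h' : R) f df p :
  is_derive (f p) 1 h h' -> is_diff p f df ->
  is_diff p (fun q => h (f q)) (fun v => df v * h').
Proof.
move=> hh fdf.
have dh : differentiable h (f p) by apply/derivable1_diffP; case: hh.
have hd : is_diff (f p) h (fun t => t * h').
  by apply: DiffDef => //; rewrite diff1E // derive1E derive_val.
exact: is_diff_comp.
Qed.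

Lemma is_diff_sin f df p : is_diff p f df ->
  is_diff p (fun q => sin (f q)) (fun v => df v * cos (f p)).
Proof. exact: is_diff_chain. Qed.

Lemma is_diff_cos f df p : is_diff p f df ->
  is_diff p (fun q => cos (f q)) (fun v => df v * - sin (f p)).
Proof. exact: is_diff_chain. Qed.

(** The real part of $n(x+iy)^{n-1}(dx+i\,dy)$. At $n=0$ the truncated predecessor does no harm, as
    the factor $n$ vanishes. *)
Definition dharmP (n : nat) (x y dx dy : R) :=
  n%:R * (harmP n.-1 x y * dx - harmQ n.-1 x y * dy).

Definition dharmQ (n : nat) (x y dx dy : R) :=
  n%:R * (harmQ n.-1 x y * dx + harmP n.-1 x y * dy).

Lemma is_diff_harm (n : nat) f g df dg p :
  is_diff p f df -> is_diff p g dg ->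
  is_diff p (fun q => harmP n (f q) (g q))
    (fun v => dharmP n (f p) (g p) (df v) (dg v)) /\
  is_diff p (fun q => harmQ n (f q) (g q))
    (fun v => dharmQ n (f p) (g p) (df v) (dg v)).
Proof.
rewrite /dharmP /dharmQ => hf hg; elim: n => [|n [IHP IHQ]].
  split; [under eq_fun do rewrite harmP0 | under eq_fun do rewrite harmQ0].
    by apply: (is_diff_ext _ _ _ _ (is_diff_const _ _)) => v; rewrite mul0r.
  by apply: (is_diff_ext _ _ _ _ (is_diff_const _ _)) => v; rewrite mul0r.
split.
- under eq_fun do rewrite harmPS.
  apply: (is_diff_ext _ _ _ _ (is_diff_sub _ _ _ _ _
    (is_diff_mul _ _ _ _ _ hf IHP) (is_diff_mul _ _ _ _ _ hg IHQ))).
  (* The predecessor reduces only after this case split; in the successor case the recurrences bring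
     both sides down to degree [n]. *)
  move=> v; case: n {IHP IHQ} => [|n]; first by rewrite /=; ring.
  by rewrite !harmE [n.+2%:R]mulrSr /=; ring.
- under eq_fun do rewrite harmQS.
  apply: (is_diff_ext _ _ _ _ (is_diff_add _ _ _ _ _
    (is_diff_mul _ _ _ _ _ hf IHQ) (is_diff_mul _ _ _ _ _ hg IHP))).
  move=> v; case: n {IHP IHQ} => [|n]; first by rewrite /=; ring.
  by rewrite !harmE [n.+2%:R]mulrSr /=; ring.
Qed.

Lemma is_diff_harmP (n : nat) f g df dg p :
  is_diff p f df -> is_diff p g dg ->
  is_diff p (fun q => harmP n (f q) (g q))
    (fun v => dharmP n (f p) (g p) (df v) (dg v)).
Proof. by move=> hf hg; case: (is_diff_harm n _ _ _ _ _ hf hg). Qed.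

Lemma is_diff_harmQ (n : nat) f g df dg p :
  is_diff p f df -> is_diff p g dg ->
  is_diff p (fun q => harmQ n (f q) (g q))
    (fun v => dharmQ n (f p) (g p) (df v) (dg v)).
Proof. by move=> hf hg; case: (is_diff_harm n _ _ _ _ _ hf hg). Qed.

End Differentials.

Arguments dharmP {R}.
Arguments dharmQ {R}.

(** * Symmetry and curl of cyclic fields *)

Section CyclicField.
Variable R : realType.
Implicit Types (G : R -> R -> R -> R) (p v : 'cV[R]_3).

Lemma cyclic_fieldE0 G p : cyclic_field G p 0 0 = G (p 0 0) (p 1 0) (p 2 0).
Proof. by rewrite mxE. Qed.

Lemma cyclic_fieldE1 G p : cyclic_field G p 1 0 = G (p 1 0) (p 2 0) (p 0 0).
Proof. by rewrite mxE. Qed.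

Lemma cyclic_fieldE2 G p : cyclic_field G p 2 0 = G (p 2 0) (p 0 0) (p 1 0).
Proof. by rewrite mxE. Qed.

Definition cyclic_fieldE := (cyclic_fieldE0, cyclic_fieldE1, cyclic_fieldE2).

Lemma col3P p v :
  p 0 0 = v 0 0 -> p 1 0 = v 1 0 -> p 2 0 = v 2 0 -> p = v.
Proof.
move=> h0 h1 h2; apply/matrixP => i j; rewrite (ord1 j).
by case: i => [[|[|[|//]]] hi]; [move: h0 | move: h1 | move: h2];
  congr (_ = _); congr fun_of_matrix; apply: val_inj.
Qed.

Lemma mulmx_col3E (A : 'M[R]_3) p i :
  (A *m p) i 0 = A i 0 * p 0 0 + A i 1 * p 1 0 + A i 2 * p 2 0.
Proof.
rewrite mxE !big_ord_recl big_ord0 addr0 addrA.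
by congr (_ + A i _ * p _ 0 + A i _ * p _ 0); apply: val_inj.
Qed.

Lemma mul_alpha p : alpha_mx R *m p = vec3 (p 0 0) (- p 1 0) (- p 2 0).
Proof. by apply: col3P; rewrite mulmx_col3E !mxE /=; ring. Qed.

Lemma mul_gamma p : gamma_mx R *m p = vec3 (p 1 0) (p 2 0) (p 0 0).
Proof. by apply: col3P; rewrite mulmx_col3E !mxE /=; ring. Qed.

Lemma mul_delta3 p : delta3_mx R *m p = vec3 (p 1 0) (p 0 0) (- p 2 0).
Proof. by apply: col3P; rewrite mulmx_col3E !mxE /=; ring. Qed.

(** Reduces invertibility of the generators to their action on coordinates: [alpha_mx] and
    [delta3_mx] are involutions, [gamma_mx] has order 3. *)
Lemma col3_ext_unitmx (A B : 'M[R]_3) :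
  (forall p, A *m (B *m p) = p) -> A \in unitmx.
Proof.
move=> h; suff /mulmx1_unit[] : A *m B = 1%:M by [].
apply/matrixP => i j; have := h (delta_mx j 0).
move/matrixP/(_ i 0); rewrite mulmxA -colE !mxE eqxx andbT => ->.
by rewrite eq_sym.
Qed.

Lemma alpha_unitmx : alpha_mx R \in unitmx.
Proof.
apply: (@col3_ext_unitmx _ (alpha_mx R)) => p.
by apply: col3P; rewrite !mul_alpha !mxE /= ?opprK.
Qed.

Lemma gamma_unitmx : gamma_mx R \in unitmx.
Proof.
apply: (@col3_ext_unitmx _ (gamma_mx R *m gamma_mx R)) => p.
by apply: col3P; rewrite -mulmxA !mul_gamma !mxE.
Qed.

Lemma delta3_unitmx : delta3_mx R \in unitmx.
Proof.
apply: (@col3_ext_unitmx _ (delta3_mx R)) => p.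
by apply: col3P; rewrite !mul_delta3 !mxE /= ?opprK.
Qed.

(** The generated groups are smallest subgroups, so this reduces a symmetry to its generators. *)
Lemma GL3_subgroup_commuting (F : 'cV[R]_3 -> 'cV[R]_3) :
  GL3_subgroup [set A | A \in unitmx /\ forall p, F (A *m p) = A *m F p].
Proof.
split=> [A [] //||A B [uA hA] [uB hB]|A [uA hA]] /=.
- by split=> [|p]; rewrite ?unitmx1 ?mul1mx.
- by split=> [|p]; rewrite ?unitmx_mul ?uA // -!mulmxA hA hB.
- split=> [|p]; first by rewrite unitmx_inv.
  by rewrite -[in RHS](mulKVmx uA p) hA mulKmx.
Qed.

Lemma octahedral_symmetry F :
  (forall p, F (alpha_mx R *m p) = alpha_mx R *m F p) ->
  (forall p, F (gamma_mx R *m p) = gamma_mx R *m F p) ->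
  (forall p, F (delta3_mx R *m p) = delta3_mx R *m F p) ->
  has_symmetry (octahedral R) F.
Proof.
move=> ha hg hd A /(smallest_sub (GL3_subgroup_commuting F)) [].
  by move=> _ [] -> /=; rewrite (alpha_unitmx, gamma_unitmx, delta3_unitmx).
by move=> uA hA; apply/funext => p; rewrite hA mulKmx.
Qed.

Lemma tetrahedral_sub_octahedral : (tetrahedral R `<=` octahedral R)%classic.
Proof.
move=> A tA B [subB gB]; apply: tA; split=> // C [] ->; apply: gB.
  exact: Or31.
exact: Or32.
Qed.

(* The first component of an octahedral field is invariant under the quarter
   turn (a, b, c) -> (a, -c, b) about its axis and changes sign under the half
   turn (a, b, c) -> (-a, c, b); for a cyclic field this is also sufficient. *)
Lemma cyclic_field_octahedral G :
  (forall a b c, G (- a) b c = - G a c b) ->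
  (forall a b c, G a (- b) c = G a c b) ->
  has_symmetry (octahedral R) (cyclic_field G).
Proof.
move=> h1 h2; have h3 a b c : G a b (- c) = G a c b.
  (* The quarter turn has order four: three uses of [h2] give its inverse. *)
  by rewrite -[b in LHS]opprK !h2.
apply: octahedral_symmetry => p.
- by rewrite !mul_alpha; apply: col3P; rewrite !mxE /= ?h1 ?h2 ?h3.
- by rewrite !mul_gamma; apply: col3P; rewrite !mxE.
- by rewrite !mul_delta3; apply: col3P; rewrite !mxE /= ?h1 ?h2 ?h3.
Qed.

(** A coordinate is linear and continuous, hence its own differential; [fL] carries the linear
    structure that [diff_lin] expects. *)
Lemma is_diff_coord (i : 'I_3) p :
  is_diff p (fun q : 'cV[R]_3 => q i 0) (fun v => v i 0).
Proof.
pose f := (fun q : 'cV[R]_3 => q i 0).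
have flin : linear f by move=> a u v; rewrite /f !mxE.
pose fM := GRing.isLinear.Build _ _ _ _ f flin.
pose fL : {linear _ -> _} := HB.pack f fM.
apply: DiffDef; first exact: differentiable_coord.
exact: (@diff_lin _ _ _ fL _ (@coord_continuous _ _ _ i 0)).
Qed.

Section Curl.
Variables (G : R -> R -> R -> R) (dG : R -> R -> R -> R -> R -> R -> R).
(** With arbitrary indices, one differential serves all three components, which differ only by a
    cyclic permutation of the coordinates. *)
Hypothesis is_diffG : forall (i j k : 'I_3) p,
  is_diff p (fun q => G (q i 0) (q j 0) (q k 0))
    (fun v => dG (p i 0) (p j 0) (p k 0) (v i 0) (v j 0) (v k 0)).

Lemma differentiable_cyclic_field p : differentiable (cyclic_field G) p.
Proof.
pose e (i : 'I_3) : 'cV[R]_3 := delta_mx i 0.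
(* In the standard basis, each summand is a scalar function times a constant vector. *)
have -> : cyclic_field G = (fun q => G (q 0 0) (q 1 0) (q 2 0) *: e 0)
    \+ (fun q => G (q 1 0) (q 2 0) (q 0 0) *: e 1)
    \+ (fun q => G (q 2 0) (q 0 0) (q 1 0) *: e 2).
  by apply/funext => q; apply: col3P; rewrite !mxE /=; ring.
by do 2?apply: differentiableD; apply: differentiableZl;
  apply: ex_diff; apply: is_diffG.
Qed.

Lemma partial_cyclic (m i j k : 'I_3) p :
  partial m (fun q => G (q i 0) (q j 0) (q k 0)) p =
  dG (p i 0) (p j 0) (p k 0) (i == m)%:R (j == m)%:R (k == m)%:R.
Proof.
have dGp := is_diffG i j k p; rewrite /partial deriveE; last exact: ex_diff.
by rewrite diff_val !mxE !andbT.
Qed.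

Lemma curl_cyclic_field :
  (forall x y z, dG z x y 0 0 1 - dG y z x 0 1 0 = G x y z) ->
  curl (cyclic_field G) = cyclic_field G.
Proof.
move=> hG; apply/funext => p; rewrite /curl.
have -> : (fun q => cyclic_field G q 0 0) = fun q => G (q 0 0) (q 1 0) (q 2 0).
  by apply/funext => q; rewrite cyclic_fieldE.
have -> : (fun q => cyclic_field G q 1 0) = fun q => G (q 1 0) (q 2 0) (q 0 0).
  by apply/funext => q; rewrite cyclic_fieldE.
have -> : (fun q => cyclic_field G q 2 0) = fun q => G (q 2 0) (q 0 0) (q 1 0).
  by apply/funext => q; rewrite cyclic_fieldE.
by rewrite !partial_cyclic /=; apply: col3P; rewrite !mxE /= -hG.
Qed.

End Curl.
End CyclicField.

(** * The two functions $\mathfrak{G}$: sign rules, differentials, curl identity *)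

Section Fields.
Variable R : realType.
Implicit Types (a b c x y z dx dy dz : R) (l : nat).

Lemma G_firstE l x y z : G_first l x y z =
  harmQ (4 * l).+3 x y * sin z - harmQ (4 * l).+3 x z * sin y
  + harmQ (4 * l).+3 z x * cos y + harmQ (4 * l).+3 y x * cos z.
Proof. by rewrite /G_first addn3. Qed.

(* The index 4l - 1 is replaced by 4(l.-1) + 3, which satisfies the same
   swap rules for every l and only differs at l = 0, where its factor is 0. *)
Lemma G_secondE l x y z : G_second l x y z =
  harmQ (4 * l).+1 x y * sin z - harmQ (4 * l).+1 x z * sin y
  + (8 * l + 2)%N%:R * harmQ (4 * l)%N y z * cos x
  + harmQ (4 * l).+1 z x * cos y + harmQ (4 * l).+1 y x * cos z
  - (8 * l + 2)%N%:R * harmP (4 * l)%N y z * sin x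
  + (4 * l)%N%:R * (8 * l + 2)%N%:R * harmP (4 * l.-1).+3 x y * cos z
  + (4 * l)%N%:R * (8 * l + 2)%N%:R * harmP (4 * l.-1).+3 x z * cos y.
Proof.
rewrite /G_second -PoszD addn1; case: l => [|l]; first by rewrite !mul0r.
have -> : (4 * l.+1)%N%:Z - 1 = (4 * l).+3%:Z by lia.
by [].
Qed.

Lemma G_first_oppl l a b c : G_first l (- a) b c = - G_first l a c b.
Proof.
rewrite !G_firstE !(harmQ_oppl, harmQ_oppr) !exprS sign4.
(* The index is odd, so $Q$ is even in its first argument and odd in its second. Only these parities
   matter, so [q] can be arbitrary. *)
move: (harmQ _) => q; ring.
Qed.

Lemma G_first_oppm l a b c : G_first l a (- b) c = G_first l a c b.
Proof.
rewrite !G_firstE !(harmQ_oppl, harmQ_oppr) !exprS sign4 sinN cosN.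
move: (harmQ _) => q; ring.
Qed.

Lemma G_second_oppl l a b c : G_second l (- a) b c = - G_second l a c b.
Proof.
rewrite !G_secondE !(harmQ_oppl, harmQ_oppr, harmP_oppl, harmP_oppr).
(* The exchange rules bring the degree $4l$ terms on both sides to the argument order $(b,c)$. *)
rewrite !exprS !sign4 sinN cosN (harmQ_swap4 _ _ b c) (harmP_swap4 _ _ b c).
move: (harmQ (4 * l).+1) (harmQ (4 * l)%N) (harmP _.+3) (harmP (4 * l)%N).
move=> q1 q0 p3 p0; move: (4 * l)%N%:R (8 * l + 2)%N%:R => d e; ring.
Qed.

Lemma G_second_oppm l a b c : G_second l a (- b) c = G_second l a c b.
Proof.
rewrite !G_secondE !(harmQ_oppl, harmQ_oppr, harmP_oppl, harmP_oppr).
rewrite !exprS !sign4 sinN cosN (harmQ_swap4 _ _ b c) (harmP_swap4 _ _ b c).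
move: (harmQ (4 * l).+1) (harmQ (4 * l)%N) (harmP _.+3) (harmP (4 * l)%N).
move=> q1 q0 p3 p0; move: (4 * l)%N%:R (8 * l + 2)%N%:R => d e; ring.
Qed.

Definition dG_first l x y z dx dy dz : R :=
  let n := (4 * l).+3 in
  dharmQ n x y dx dy * sin z + harmQ n x y * cos z * dz
  - (dharmQ n x z dx dz * sin y + harmQ n x z * cos y * dy)
  + (dharmQ n z x dz dx * cos y - harmQ n z x * sin y * dy)
  + (dharmQ n y x dy dx * cos z - harmQ n y x * sin z * dz).

Definition dG_second l x y z dx dy dz : R :=
  let n := (4 * l)%N in
  let m := (4 * l.-1).+3 in
  let c := (8 * l + 2)%N%:R in
  dharmQ n.+1 x y dx dy * sin z + harmQ n.+1 x y * cos z * dz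
  - (dharmQ n.+1 x z dx dz * sin y + harmQ n.+1 x z * cos y * dy)
  + c * (dharmQ n y z dy dz * cos x - harmQ n y z * sin x * dx)
  + (dharmQ n.+1 z x dz dx * cos y - harmQ n.+1 z x * sin y * dy)
  + (dharmQ n.+1 y x dy dx * cos z - harmQ n.+1 y x * sin z * dz)
  - c * (dharmP n y z dy dz * sin x + harmP n y z * cos x * dx)
  + n%:R * c * (dharmP m x y dx dy * cos z - harmP m x y * sin z * dz)
  + n%:R * c * (dharmP m x z dx dz * cos y - harmP m x z * sin y * dy).

(** Descends through the formula while unification builds the differential, left open by
    [is_diff_ext]; constant factors reach the last case. *)
Ltac is_diff_tac := lazymatch goal with
  | |- is_diff _ (fun q => @?f q - @?g q) _ =>
      eapply (is_diff_sub _ _ f g); is_diff_tac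
  | |- is_diff _ (fun q => @?f q + @?g q) _ =>
      eapply (is_diff_add _ _ f g); is_diff_tac
  | |- is_diff _ (fun q => @?f q * @?g q) _ =>
      eapply (is_diff_mul _ _ f g); is_diff_tac
  | |- is_diff _ (fun q => sin _) _ => apply: is_diff_sin; is_diff_tac
  | |- is_diff _ (fun q => cos _) _ => apply: is_diff_cos; is_diff_tac
  | |- is_diff _ (fun q => harmP _ _ _) _ => apply: is_diff_harmP; is_diff_tac
  | |- is_diff _ (fun q => harmQ _ _ _) _ => apply: is_diff_harmQ; is_diff_tac
  | |- is_diff _ (fun q => fun_of_matrix q _ _) _ => apply: is_diff_coord
  | |- _ => apply: is_diff_const
  end.

Lemma is_diff_G_first l (i j k : 'I_3) (p : 'cV[R]_3) :
  is_diff p (fun q => G_first l (q i 0) (q j 0) (q k 0))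
    (fun v => dG_first l (p i 0) (p j 0) (p k 0) (v i 0) (v j 0) (v k 0)).
Proof.
under eq_fun do rewrite G_firstE.
eapply is_diff_ext; first by is_diff_tac.
move=> v; rewrite /dG_first; move: (harmQ _) (dharmQ _) => q dq; ring.
Qed.

Lemma is_diff_G_second l (i j k : 'I_3) (p : 'cV[R]_3) :
  is_diff p (fun q => G_second l (q i 0) (q j 0) (q k 0))
    (fun v => dG_second l (p i 0) (p j 0) (p k 0) (v i 0) (v j 0) (v k 0)).
Proof.
under eq_fun do rewrite G_secondE.
eapply is_diff_ext; first by is_diff_tac.
move=> v; rewrite /dG_second; move: (harmQ (4 * l).+1) (dharmQ (4 * l).+1).
move: (harmQ (4 * l)%N) (dharmQ (4 * l)%N) (harmP (4 * l)%N) (dharmP (4 * l)%N).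
move: (harmP _) (dharmP _) (4 * l)%N%:R (8 * l + 2)%N%:R.
move=> p3 dp3 n c q0 dq0 p0 dp0 q1 dq1; ring.
Qed.

(** Differentiating sines and cosines reproduces $\mathfrak{G}$. Differentiating $Q_{4l+3}$ leaves
    multiples of $P_{4l+2}(y,z)+P_{4l+2}(z,y)$ and $Q_{4l+2}(y,z)-Q_{4l+2}(z,y)$, both zero. *)
Lemma curl_G_first l x y z :
  dG_first l z x y 0 0 1 - dG_first l y z x 0 1 0 = G_first l x y z.
Proof.
rewrite /dG_first /dharmQ G_firstE [_.+3.-1]/=.
rewrite (harmP_swap4D2 _ _ y z) (harmQ_swap4D2 _ _ y z).
move: (harmQ (4 * l).+3) (harmQ (4 * l).+2) (harmP _) (4 * l).+3%:R.
move=> q3 q2 p2 n; ring.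
Qed.

(** Puts the degree $4l-1$ into the form used in [G_secondE]; at $l=0$ both sides vanish. *)
Lemma dharm4E l x y dx dy :
  dharmP (4 * l)%N x y dx dy = (4 * l)%N%:R *
    (harmP (4 * l.-1).+3 x y * dx - harmQ (4 * l.-1).+3 x y * dy) /\
  dharmQ (4 * l)%N x y dx dy = (4 * l)%N%:R *
    (harmQ (4 * l.-1).+3 x y * dx + harmP (4 * l.-1).+3 x y * dy).
Proof.
rewrite /dharmP /dharmQ; case: l => [|l]; first by rewrite !mul0r.
by have -> : (4 * l.+1)%N.-1 = (4 * l).+3 by lia.
Qed.

Lemma dharmP4E l x y dx dy : dharmP (4 * l)%N x y dx dy =
  (4 * l)%N%:R * (harmP (4 * l.-1).+3 x y * dx - harmQ (4 * l.-1).+3 x y * dy).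
Proof. by case: (dharm4E l x y dx dy). Qed.

Lemma dharmQ4E l x y dx dy : dharmQ (4 * l)%N x y dx dy =
  (4 * l)%N%:R * (harmQ (4 * l.-1).+3 x y * dx + harmP (4 * l.-1).+3 x y * dy).
Proof. by case: (dharm4E l x y dx dy). Qed.

(** In degree $4l$, $P$ is symmetric and $Q$ antisymmetric, so the derivatives of $Q_{4l+1}$ double
    instead of cancelling: hence the coefficient $8l+2=2(4l+1)$. Among the derivatives of the other
    terms, with $m=4(l-1)+3$, the $Q_{m-1}$ terms cancel by symmetry, and $P_m(y,x)=-Q_m(x,y)$
    removes the $\sin z$ terms and turns $-Q_m(z,x)\cos y$ into $P_m(x,z)\cos y$. *)
Lemma curl_G_second l x y z :
  dG_second l z x y 0 0 1 - dG_second l y z x 0 1 0 = G_second l x y z.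
Proof.
rewrite /dG_second !dharmP4E !dharmQ4E /dharmP /dharmQ G_secondE.
rewrite ![_.+1.-1]/=.
have -> : (8 * l + 2)%N%:R = 2 * (1 + (4 * l)%N%:R) :> R.
  by rewrite nat1r -natrM; congr _%:R; lia.
rewrite -[(4 * l).+1%:R]nat1r.
rewrite (harmP_swap4 _ _ y z) (harmQ_swap4 _ _ y z).
rewrite (harmP_swap4D3 _ _ x y) (harmP_swap4D3 _ _ z x).
rewrite (harmQ_swap4D2 _ _ y z).
move: (harmQ (4 * l).+1) (harmQ (4 * l)%N) (harmP (4 * l)%N).
move: (harmQ (4 * l.-1).+3) (harmP (4 * l.-1).+3).
move: (harmQ (4 * l.-1).+2) (harmP (4 * l.-1).+2).
move: (4 * l)%N%:R (4 * l.-1).+3%:R.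
move=> n m q2 p2 q3 p3 q1 q0 p0.
ring.
Qed.

End Fields.

(** Directional derivatives are total here; differentiability is included so that [curl] is the
    genuine curl. *)
Theorem theorem2 (R : realType) (l : nat) (G : R -> R -> R -> R)
    (hG : G = G_first l \/ G = G_second l) :
  let V := cyclic_field G in
  [/\ has_symmetry (octahedral R) V,
      has_symmetry (tetrahedral R) V,
      (forall p : 'cV[R]_3, differentiable V p) &
      curl V = V].
Proof.
move=> V; suff [hO dV cV] : [/\ has_symmetry (octahedral R) V,
    (forall p, differentiable V p) & curl V = V].
  by split=> // A /tetrahedral_sub_octahedral; apply: hO.
rewrite /V; case: hG => ->; split.
- by apply: cyclic_field_octahedral; [exact: G_first_oppl|exact: G_first_oppm].
- exact/differentiable_cyclic_field/is_diff_G_first.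
- exact: (curl_cyclic_field _ _ _ (is_diff_G_first _ l) (curl_G_first _ l)).
- by apply: cyclic_field_octahedral; [exact: G_second_oppl|exact: G_second_oppm].
- exact/differentiable_cyclic_field/is_diff_G_second.
- exact: (curl_cyclic_field _ _ _ (is_diff_G_second _ l) (curl_G_second _ l)).
Qed.
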